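(* Let $k$ be a positive integer. Every $(2k+1)$-regular graph $G$ admits a $\{1,2,\ldots,k\}$-avoiding orientation, that is, an orientation $D$ such that $d_D^+(v)\notin\{1,2,\ldots,k\}$ for every $v\in V(G)$.
   Context: All graphs are finite and loopless; parallel edges are permitted, and degrees count edges with multiplicity. An orientation $D$ of $G$ assigns a direction to each edge, so that each edge points out of one endpoint and into the other; $d_D^+(v)$ is the number of edges pointing out of $v$ in $D$. *)

(* Defs.v *)
From mathcomp Require Import all_boot.

Set Implicit Arguments.
Unset Strict Implicit.
Unset Printing Implicit Defensive.

(* Parallel edges are distinct elements of [edge] with the same set of ends;
   loops are excluded because an edge has exactly two ends. *)
Record multigraph : Type := Multigraph {
  vertex : finType;
  edge : finType;
  ends : edge -> {set vertex};
  card_ends : forall e : edge, #|ends e| = 2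
}.

Definition degree (G : multigraph) (v : vertex G) : nat :=
  #|[set e : edge G | v \in ends e]|.

Definition regular (d : nat) (G : multigraph) : Prop :=
  forall v : vertex G, degree v = d.

(* [tail e] and [tip e] are automatically distinct, by [card_ends]. *)
Record orientation (G : multigraph) : Type := Orientation {
  tail : edge G -> vertex G;
  tip : edge G -> vertex G;
  ends_tail_tip : forall e : edge G, ends e = [set tail e; tip e]
}.

Definition outdegree (G : multigraph) (D : orientation G) (v : vertex G) : nat :=
  #|[set e : edge G | tail D e == v]|.

Definition avoiding (F : {pred nat}) (G : multigraph) (D : orientation G) : Prop :=
  forall v : vertex G, outdegree D v \notin F.

(* Main.v *)
Require Import Defs.
From mathcomp Require Import all_boot.
From mathcomp Require Import zify.

(** Take a maximal independent set [S] and orient every edge that meets [S]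
    towards its end in [S], so that the vertices of [S] get out-degree 0.  Orient
    the remaining edges in a balanced way: at every vertex the numbers of
    outgoing and of incoming edges differ by at most one
    ([balanced_orientation]).  A vertex outside [S] has, by maximality, at least
    one edge to [S]; that edge is outgoing and makes up for the possible deficit
    of one, so at least half of the [2k+1] edges at the vertex are outgoing,
    which means at least [k+1] of them.

    The balanced orientation is found by splitting off: two edges [xa] and [xb]
    with a common end [x] are replaced by a single edge [ab].  If [ab] is
    directed from [a] to [b], directing [xa] and [xb] along the path from [a]
    through [x] to [b] changes the balance of no vertex.  When no two edges
    share an end, every orientation is balanced. *)

Set Implicit Arguments.
Unset Strict Implicit.
Unset Printing Implicit Defensive.

Lemma set2_inj (V : finType) (a b c d : V) :
  [set a; b] = [set c; d] -> (a = c /\ b = d) \/ (a = d /\ b = c).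
Proof.
move=> eq_ab_cd.
have := set21 a b; have := set22 a b; rewrite eq_ab_cd.
have := set21 c d; have := set22 c d; rewrite -{1 2}eq_ab_cd !inE.
by do 4![case/orP=> /eqP ?]; subst; auto.
Qed.

Lemma set2_mem (V : finType) (x a b : V) :
  x \in [set a; b] -> exists c, [set a; b] = [set x; c].
Proof. by case/set2P=> ->; [exists b | exists a; rewrite setUC]. Qed.

(** Induction on the number of edges, by splitting off.  The set [A] allows the
    merged edge to reuse the name of one of the two edges while the other leaves
    [A].  Loops are allowed, as splitting off two parallel edges creates one; a
    loop leaves and enters its vertex, so it does not affect the balance. *)
Lemma balanced_orientation (V E : finType) (A : {set E}) (ends : E -> {set V}) :
  (forall e, exists a b, ends e = [set a; b]) ->
  exists t h : E -> V,
    (forall e, e \in A -> ends e = [set t e; h e]) /\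
    (forall v, \sum_(e in A) (h e == v) <= (\sum_(e in A) (t e == v)).+1 /\
               \sum_(e in A) (t e == v) <= (\sum_(e in A) (h e == v)).+1).
Proof.
have [n] := ubnP #|A|; elim: n A ends => // n IHn A ends ltAn ends2.
have [/existsP[x /exists_inP[e Ae /exists_inP[f Af /and3P[neq_fe xe xf]]]]|no_pair]
  := boolP [exists x, [exists e in A, [exists f in A,
             [&& f != e, x \in ends e & x \in ends f]]]].
- have [a def_e] : exists a, ends e = [set x; a].
    by have [a [b def_e]] := ends2 e; rewrite def_e in xe *; apply: set2_mem.
  have [b def_f] : exists b, ends f = [set x; b].
    by have [c [b def_f]] := ends2 f; rewrite def_f in xf *; apply: set2_mem.
  pose ends' g := if g == e then [set a; b] else ends g.
  have [||t [h [def_ends' bal]]] := IHn (A :\ f) ends'.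
  + by move: ltAn; rewrite (cardsD1 f A) Af.
  + by move=> g; rewrite /ends'; case: eqP => _; [exists a, b | exact: ends2].
  have Afe : e \in A :\ f by rewrite !inE eq_sym neq_fe.
  have sumA (u : E -> V) v : \sum_(g in A) (u g == v) =
      (u f == v) + ((u e == v) + \sum_(g in A :\ f :\ e) (u g == v)).
    by rewrite (big_setD1 f) //= (big_setD1 e).
  have sumA' (u : E -> V) v : \sum_(g in A :\ f) (u g == v) =
      (u e == v) + \sum_(g in A :\ f :\ e) (u g == v).
    by rewrite (big_setD1 e).
  pose upd (u : E -> V) ue uf g := if g == e then ue else if g == f then uf else u g.
  have upd_e u ue uf : upd u ue uf e = ue by rewrite /upd eqxx.
  have upd_f u ue uf : upd u ue uf f = uf.
    by rewrite /upd (negPf neq_fe) eqxx.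
  have sum_upd u ue uf v : \sum_(g in A :\ f :\ e) (upd u ue uf g == v) =
      \sum_(g in A :\ f :\ e) (u g == v).
    by apply: eq_bigr => g; rewrite !inE /upd => /and3P[/negPf-> /negPf->].
  (* The path along [e] and [f] follows the direction given to the merged edge. *)
  have [te [tf [he [hf [def_e2 def_f2 bal_ef]]]]] : exists te tf he hf,
      [/\ ends e = [set te; he], ends f = [set tf; hf] &
          forall v, (te == v) + (tf == v) = (x == v) + (t e == v) /\
                    (he == v) + (hf == v) = (x == v) + (h e == v)].
    have := def_ends' e Afe; rewrite /ends' eqxx => /esym/set2_inj[][-> ->].
      exists a, x, x, b; split=> // [|v]; first by rewrite setUC.
      by split; rewrite // addnC.
    exists x, b, a, x; split=> // [|v]; first by rewrite setUC.
    by split; rewrite // addnC.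
  exists (upd t te tf), (upd h he hf); split=> [g Ag|v].
    rewrite /upd; have [->//|neq_ge] := eqVneq g e.
    have [->//|neq_gf] := eqVneq g f.
    have := def_ends' g; rewrite !inE neq_gf => /(_ Ag).
    by rewrite /ends' (negPf neq_ge).
  have := bal v; rewrite !sumA !sumA' !upd_e !upd_f !sum_upd.
  by have := bal_ef v; lia.
- have /fin_all_exists[p def_ends] e : exists p : V * V, ends e = [set p.1; p.2].
    by have [a [b ->]] := ends2 e; exists (a, b).
  have le1 (u : E -> V) v : (forall e, u e \in ends e) ->
      \sum_(e in A) (u e == v) <= 1.
    move=> u_ends; have [/exists_inP[e Ae /eqP def_v]|no_e] :=
      boolP [exists e in A, u e == v]; last first.
      rewrite big1 // => e Ae; have [/eqP ue|//] := boolP (u e == v).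
      by case/exists_inP: no_e; exists e; rewrite // ue.
    rewrite (big_setD1 e) //= big1 ?addn0 ?leq_b1 // => f; rewrite !inE.
    case/andP=> neq_fe Af; have [uf|//] := eqVneq (u f) v.
    case/existsP: no_pair; exists v; apply/exists_inP; exists e => //.
    by apply/exists_inP; exists f; rewrite // neq_fe -{1}def_v -uf !u_ends.
  exists (fun e => (p e).1), (fun e => (p e).2); split=> // v.
  by split; apply: leq_trans (le1 _ v _) _ => // e; rewrite def_ends !inE eqxx ?orbT.
Qed.

(** If [v] cannot be added to a maximal independent set [S], then some edge lies
    inside [S] with [v] added; as neither [S] nor [[set v]] contains an edge, this
    edge joins [v] to [S]. *)
Lemma maximal_independent_set (G : multigraph) :
  exists S : {set vertex G},
    (forall e, ~~ (ends e \subset S)) /\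
    (forall v, v \notin S -> exists2 e, v \in ends e & ~~ [disjoint ends e & S]).
Proof.
pose independent (S : {set vertex G}) := [forall e : edge G, ~~ (ends e \subset S)].
have indep0 : independent set0.
  by apply/forallP=> e; rewrite subset0 -cards_eq0 card_ends.
have [S /maxsetP[/forallP indepS maxS] _] := maxset_exists indep0.
exists S; split=> // v notSv.
have [/maxS|/forallPn[e /negPn sub_e]] := boolP (independent (v |: S)).
  by move=> eqS; rewrite -eqS ?subsetUr ?setU11 in notSv.
exists e.
  apply: contraR (indepS e) => not_ev; apply/subsetP=> w ew.
  by have /setU1P[eq_wv|//] := subsetP sub_e w ew; rewrite -eq_wv ew in not_ev.
apply/negP=> /pred0P disj.
(* Otherwise [v] would be the only end of [e]. *)
have : ends e \subset [set v].
  apply/subsetP=> w ew; have /setU1P[->|Sw] := subsetP sub_e w ew; first exact: set11.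
  by have := disj w; rewrite /= ew Sw.
by move/subset_leq_card; rewrite card_ends cards1.
Qed.

Lemma outdegree_sum (G : multigraph) (D : orientation G) v :
  outdegree D v = \sum_e (tail D e == v).
Proof. by rewrite /outdegree -sum1dep_card big_mkcond. Qed.

Lemma degree_out_in (G : multigraph) (D : orientation G) v :
  degree v = outdegree D v + \sum_e (tip D e == v).
Proof.
rewrite outdegree_sum -big_split /degree -sum1dep_card big_mkcond /=.
apply: eq_bigr => e _; have := card_ends e.
rewrite (ends_tail_tip D) cards2 !inE ![v == _]eq_sym.
by have [<-|_] := eqVneq (tail D e) v; case: eqVneq => //=; case: eqVneq.
Qed.

Theorem theorem8 (k : nat) (hk : 0 < k) (G : multigraph)
    (hG : regular (2 * k + 1) G) :
  exists D : orientation G, avoiding [pred d : nat | 1 <= d <= k] D.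
Proof.
have [S [indepS maxS]] := maximal_independent_set G.
pose A := [set e : edge G | [disjoint ends e & S]].
have [|t [h [def_ends bal]]] := @balanced_orientation _ _ A (@ends G).
  move=> e; have /eqP/cards2P[a [b [_ def_e]]] := card_ends e.
  by exists a, b.
have /fin_all_exists[p pP] (e : edge G) : exists p : vertex G * vertex G,
    ends e = [set p.1; p.2] /\
    (if e \in A then p = (t e, h e) else p.1 \notin S /\ p.2 \in S).
  have [Ae|] := boolP (e \in A); first by exists (t e, h e); rewrite -def_ends.
  rewrite inE => /pred0Pn[x /andP[/= ex Sx]].
  have /subsetPn[y ey notSy] := indepS e.
  exists (y, x); split=> //=; apply/esym/eqP.
  rewrite eqEcard subUset !sub1set ex ey card_ends cards2.
  by case: eqP notSy => // ->; rewrite Sx.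
pose D := Orientation (fun e => (pP e).1); exists D => v; rewrite inE.
have [Sv|notSv] := boolP (v \in S).
  rewrite outdegree_sum big1 // => e _; apply/eqP; rewrite eqb0; apply/eqP=> /= tl.
  have [def_e] := pP e; case: ifP => [|_ []]; last by rewrite tl Sv.
  by rewrite inE => /pred0P/(_ v); rewrite /= Sv def_e -tl set21.
have le_in_out : \sum_e (tip D e == v) <= outdegree D v.
  rewrite outdegree_sum (bigID (mem A)) [leqRHS](bigID (mem A)) /=.
  rewrite [X in _ + X]big1 ?addn0 => [|e /negPf notAe]; last first.
    have [_] := pP e; rewrite notAe => -[_ S_tip].
    by case: eqP S_tip notSv => // -> ->.
  have tA e : e \in A -> p e = (t e, h e) by have [_] := pP e; case: ifP.
  rewrite (eq_bigr (fun e => nat_of_bool (h e == v))) => [|e /tA-> //].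
  rewrite [in leqRHS](eq_bigr (fun e => nat_of_bool (t e == v))) => [|e /tA-> //].
  (* The edge from [v] into [S] compensates the deficit of one inside [A]. *)
  have [e ev meet_e] := maxS v notSv.
  have notAe : e \notin A by rewrite inE.
  rewrite [X in _ <= _ + X](bigD1 e) //=.
  have -> : (p e).1 == v.
    have [def_e] := pP e; rewrite (negPf notAe) => -[_ S_tip].
    move: ev; rewrite def_e => /set2P[->|def_v] //.
    by rewrite def_v S_tip in notSv.
  by have [le_bal _] := bal v; move: le_bal => /=; lia.
by have := degree_out_in D v; rewrite hG; lia.
Qed.
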